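(* Every infinite indexed language $L$ has an infinite subset which is a CD0L language.
   Context: Indexed languages are the languages generated by indexed grammars (Aho's grammars in which nonterminals carry stacks that can be pushed, popped and copied). A morphism on an alphabet $A$ is a map $h:A^*\to A^*$ with $h(xy)=h(x)h(y)$; it is a coding if $|h(a)|=1$ for all $a\in A$. A CD0L system is a tuple $(A,h,w,g)$ with $A$ an alphabet, $h$ a morphism on $A$, $g$ a coding on $A$, and $w\in A^*$; its language is $\{g(h^i(w)):i\ge0\}$. A CD0L language is the language of some CD0L system. *)

(* Defs.v *)
From mathcomp Require Import all_boot.
From Stdlib Require Import Relations.
From Stdlib Require List.

Set Implicit Arguments.
Unset Strict Implicit.
Unset Printing Implicit Defensive.

(* ---------- Indexed grammars (Aho; normal rule format as in Hopcroft-Ullman) ---------- *)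

(* Symbols of a sentential form: terminals, or nonterminals carrying a stack
   of flags (head of the list = top of the stack). *)
Inductive sym (N F T : Type) : Type :=
| Ter : T -> sym N F T
| Nt  : N -> seq F -> sym N F T.
Arguments Ter {N F T} _.
Arguments Nt {N F T} _ _.

(* Productions:
   RCopy X rhs     :  X   -> rhs    (stack copied to every nonterminal of rhs)
   RPush X Y f     :  X   -> Y f    (push f)
   RPop  X f rhs   :  X f -> rhs    (pop f, remaining stack copied to rhs)   *)
Inductive rule (N F T : Type) : Type :=
| RCopy : N -> seq (N + T) -> rule N F T
| RPush : N -> N -> F -> rule N F T
| RPop  : N -> F -> seq (N + T) -> rule N F T.
Arguments RCopy {N F T} _ _.
Arguments RPush {N F T} _ _ _.
Arguments RPop {N F T} _ _ _.

Record indexed_grammar (T : finType) := IndexedGrammar {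
  ig_nt    : finType;
  ig_flag  : finType;
  ig_rules : seq (rule ig_nt ig_flag T);
  ig_start : ig_nt
}.

Definition expand {N F T : Type} (rhs : seq (N + T)) (st : seq F) : seq (sym N F T) :=
  map (fun s => match s with inl Y => Nt Y st | inr a => Ter a end) rhs.

Inductive ig_step (T : finType) (G : indexed_grammar T) :
  seq (sym (ig_nt G) (ig_flag G) T) -> seq (sym (ig_nt G) (ig_flag G) T) -> Prop :=
| step_copy u v X st rhs :
    List.In (RCopy X rhs) (ig_rules G) ->
    ig_step (u ++ Nt X st :: v) (u ++ expand rhs st ++ v)
| step_push u v X Y f st :
    List.In (RPush X Y f) (ig_rules G) ->
    ig_step (u ++ Nt X st :: v) (u ++ Nt Y (f :: st) :: v)
| step_pop u v X f st rhs :
    List.In (RPop X f rhs) (ig_rules G) ->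
    ig_step (u ++ Nt X (f :: st) :: v) (u ++ expand rhs st ++ v).

Definition ig_derives (T : finType) (G : indexed_grammar T) :=
  clos_refl_trans _ (@ig_step T G).

Definition ig_language (T : finType) (G : indexed_grammar T) : seq T -> Prop :=
  fun w => @ig_derives T G [:: Nt (ig_start G) [::]] (map Ter w).

Definition indexed_language (T : finType) (L : seq T -> Prop) : Prop :=
  exists G : indexed_grammar T, forall w, L w <-> ig_language G w.

Definition infinite_lang (T : Type) (L : seq T -> Prop) : Prop :=
  ~ exists s : seq (seq T), forall w, L w -> List.In w s.

(* A morphism h on A* is determined by its values on letters (h : A -> seq A);
   a coding g on A* by a letter-to-letter map (g : A -> A). *)
Definition morph_ext (A : Type) (h : A -> seq A) (u : seq A) : seq A :=
  flatten (map h u).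

Record CD0L_system := CD0LSystem {
  cd_alph : finType;
  cd_h : cd_alph -> seq cd_alph;
  cd_w : seq cd_alph;
  cd_g : cd_alph -> cd_alph
}.

Definition CD0L_lang (S : CD0L_system) : seq (cd_alph S) -> Prop :=
  fun v => exists i : nat, v = map (@cd_g S) (iter i (morph_ext (@cd_h S)) (@cd_w S)).

(* A language M of words over T is CD0L if it is the language of some CD0L
   system whose alphabet A contains T (via an injective identification e). *)
Definition CD0L_language (T : finType) (M : seq T -> Prop) : Prop :=
  exists (S : CD0L_system) (e : T -> cd_alph S),
    injective e /\
    forall v, @CD0L_lang S v <-> exists u, M u /\ v = map e u.

(* Main.v *)
Require Import Defs.
From mathcomp Require Import all_boot.
From mathcomp Require Import boolp zify.
From Stdlib Require Import Relations.
From Stdlib Require List.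

(* A configuration is a nonterminal with its stack.  If some useful
   configuration [c] derives [x c y] with [x y] nonempty, then [u x^n w y^n v]
   is the required subset.  Otherwise, on the finitely many configurations of a
   derivation of a long word, one may choose a single production for each
   configuration (longest yield first, then smallest tree); this gives an
   acyclic deterministic strategy whose yield is at least as long.  Under the
   strategy, [X] on stack [s] rewrites, before [s] is touched, to a word
   [frontier X s] of letters that are about to pop [s].  If this word has many
   letters with nonempty yield, it stems from a push leading to a word that is
   not much shorter, so a long yield produces a long chain of nested stacks
   along which the number of such letters strictly drops.  Two links of the
   chain with the same finite data give words [W_(n+1) = al h(W_n) be], where
   [h] is the effect of popping the stack segment between them; the iteration of
   this affine map is a D0L sequence, and the yields of its letters give a
   morphism into the terminals.  A suitable power of the D0L morphism makes the
   set of erased letters stable, which allows that morphism to be replaced by a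
   coding. *)

Set Implicit Arguments.
Unset Strict Implicit.
Unset Printing Implicit Defensive.

(** * Morphisms on words and their iterates *)

Definition subst (A B : Type) (f : A -> seq B) (u : seq A) : seq B :=
  flatten (map f u).

Lemma subst_cat (A B : Type) (f : A -> seq B) u v :
  subst f (u ++ v) = subst f u ++ subst f v.
Proof. by rewrite /subst map_cat flatten_cat. Qed.

Lemma subst_cons (A B : Type) (f : A -> seq B) a u :
  subst f (a :: u) = f a ++ subst f u.
Proof. by []. Qed.

Lemma subst1 (A B : Type) (f : A -> seq B) a : subst f [:: a] = f a.
Proof. exact: cats0. Qed.

Lemma subst_comp (A B C : Type) (f : A -> seq B) (g : B -> seq C) u :
  subst g (subst f u) = subst (fun a => subst g (f a)) u.
Proof. by elim: u => //= a u IH; rewrite !subst_cons subst_cat IH. Qed.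

Lemma iter_subst_cat (A : Type) (h : A -> seq A) n u v :
  iter n (subst h) (u ++ v) = iter n (subst h) u ++ iter n (subst h) v.
Proof. by elim: n => //= n ->; rewrite subst_cat. Qed.

Lemma iter_subst_letters (A : Type) (h : A -> seq A) n u :
  iter n (subst h) u = subst (fun a => iter n (subst h) [:: a]) u.
Proof.
elim: u => [|a u IH]; first by elim: n => //= n ->.
by rewrite -cat1s iter_subst_cat IH.
Qed.

Lemma iter_morph_iter (A : Type) (h : A -> seq A) q k u :
  iter k (subst (fun a => iter q (subst h) [:: a])) u = iter (k * q) (subst h) u.
Proof.
elim: k => //= k ->.
by rewrite -iter_subst_letters mulSn iterD.
Qed.

(** * Infinite languages and the pigeonhole principle *)

Lemma mem_List_In (A : eqType) (x : A) s : x \in s -> List.In x s.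
Proof.
elim: s => //= y s IH; rewrite inE => /orP [/eqP -> | /IH]; first by left.
by right.
Qed.

Lemma List_In_mem (A : eqType) (x : A) s : List.In x s -> x \in s.
Proof.
elim: s => //= y s IH; rewrite inE => [[-> | /IH ->]]; first by rewrite eqxx.
by rewrite orbT.
Qed.

Lemma infinite_lang_long (T : finType) (L : seq T -> Prop) n :
  infinite_lang L -> exists2 w, L w & n < size w.
Proof.
move=> infL; apply: contrapT => short; apply: infL.
exists (flatten [seq [seq val t | t <- enum {: k.-tuple T}] | k <- iota 0 n.+1]).
move=> w Lw; apply: mem_List_In; apply/flatten_mapP.
exists (size w); last by apply/mapP; exists (in_tuple w); rewrite ?mem_enum.
rewrite mem_iota leq0n add0n ltnS leqNgt; apply/negP => lt_w.
by apply: short; exists w.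
Qed.

Lemma unbounded_infinite_lang (T : eqType) (L : seq T -> Prop) :
  (forall n, exists2 w, L w & n <= size w) -> infinite_lang L.
Proof.
move=> long [s sP]; have [w Lw] := long (sumn (map size s)).+1.
have /List_In_mem ws := sP _ Lw.
rewrite ltnNge => /negP; apply; elim: s ws {sP} => //= v s IH.
by rewrite inE => /orP [/eqP <- | /IH]; lia.
Qed.

Lemma pigeonhole_nat (X : finType) (e : nat -> X) :
  exists i j, i < j /\ e i = e j.
Proof.
have : ~ injective (fun i : 'I_#|X|.+1 => e i).
  by move=> /leq_card; rewrite card_ord ltnn.
move=> /injectiveP /injectivePn [i [j ij eij]].
have [lt_ij|lt_ji|/val_inj eq_ij] := ltngtP i j.
- by exists i, j.
- by exists j, i.
- by rewrite eq_ij eqxx in ij.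
Qed.

(** * From morphic images of D0L sequences to CD0L languages *)

(* The set of letters erased by [g o h^n] is a function of the corresponding
   set for [n - 1], hence eventually periodic in [n]. *)
Lemma erased_letters_stable (A T : finType) (h : A -> seq A) (g : A -> seq T) :
  exists2 q, 0 < q & forall a,
    subst g (iter q (subst h) [:: a]) = [::] ->
    subst g (iter (q + q) (subst h) [:: a]) = [::].
Proof.
pose e n : {ffun A -> bool} :=
  [ffun a => subst g (iter n (subst h) [:: a]) == [::]].
have eS n a : e n.+1 a = all (e n) (h a).
  rewrite ffunE iterSr subst1 iter_subst_letters subst_comp.
  elim: (h a) => //= b u IH; rewrite subst_cons ffunE -IH.
  by case: (subst g _).
have [i [j [lt_ij eij]]] := pigeonhole_nat e.
have shift k : e (i + k) = e (j + k).
  elim: k => [|k IH]; rewrite ?addn0 // !addnS.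
  by apply/ffunP => a; rewrite !eS IH.
pose p := j - i.
have per k t : e (i + k + t * p) = e (i + k).
  elim: t => [|t IH]; first by rewrite addn0.
  have -> : i + k + t.+1 * p = j + (k + t * p) by rewrite mulSn /p; lia.
  by rewrite -shift addnA.
(* [i.+1 * p] is a multiple of the period and at least [i], so it and its double agree; the factor
   [i.+1] keeps it positive even for [i = 0]. *)
have le_iq : i <= i.+1 * p by rewrite /p; nia.
exists (i.+1 * p); first by rewrite /p; nia.
move=> a /eqP ea; apply/eqP.
have := per (i.+1 * p - i) i.+1; rewrite subnKC // => /ffunP /(_ a).
by rewrite !ffunE ea => ->.
Qed.

(** A letter [a] is spelled as a block of copies [(a, i)], one for each letter of its terminal
    image. The first copy produces the whole next image and the others vanish, so a coding can read
    each copy as one terminal. *)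
Lemma HD0L_contains_CD0L (A T : finType) (h : A -> seq A) (g : A -> seq T)
    (w : seq A) (L : seq T -> Prop) :
  (forall n, L (subst g (iter n (subst h) w))) ->
  (forall n, n <= size (subst g (iter n (subst h) w))) ->
  exists M : seq T -> Prop,
    (forall u, M u -> L u) /\ infinite_lang M /\ CD0L_language M.
Proof.
move=> inL long.
have [q q0 stab] := erased_letters_stable h g.
pose h' a := iter q (subst h) [:: a].
pose g' a := subst g (h' a).
have g'h' k : subst g' (iter k (subst h') w) = subst g (iter (k.+1 * q) (subst h) w).
  rewrite -iter_morph_iter iterS -subst_comp; congr subst.
(* Letters with empty image get an empty block; stability of [q] ensures that what they generate is
   erased as well. *)
have dead a : g' a = [::] -> subst g' (h' a) = [::].
  by move/stab; rewrite iterD iter_subst_letters subst_comp.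
pose K := \max_a size (g' a).
pose enc a : seq (T + A * 'I_K.+1) :=
  [seq inr (a, inord i) | i <- iota 0 (size (g' a))].
pose ch (x : T + A * 'I_K.+1) : seq (T + A * 'I_K.+1) :=
  if x is inr (a, i) then if i == ord0 then subst enc (h' a) else [::] else [::].
(* The fallback [x] is never met on an encoded [(a, i)]. [T] sits in the alphabet so that [inl] can
   be the identification. *)
pose cg (x : T + A * 'I_K.+1) : T + A * 'I_K.+1 :=
  if x is inr (a, i) then if onth (g' a) i is Some t then inl t else x else x.
have ch_enc a : subst ch (enc a) = subst enc (h' a).
  have [ga0|] := eqVneq (g' a) [::].
    have := dead a ga0; rewrite /enc ga0 /=.
    elim: (h' a) => //= b u IH; rewrite !subst_cons /enc.
    by case: (g' b) => // /IH.
  rewrite -size_eq0 -lt0n => ga.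
  have szK : size (g' a) <= K by exact: (leq_bigmax a).
  rewrite /enc; case: (size (g' a)) ga szK => // n _ nK /=.
  rewrite subst_cons /ch -/ch -val_eqE /= inordK //=.
  rewrite -[RHS]cats0; congr cat.
  have: forall i, i \in iota 1 n -> 0 < i <= K.
    by move=> i; rewrite mem_iota; lia.
  elim: (iota 1 n) => //= i s IH all_i.
  rewrite subst_cons IH; last by move=> j js; apply: all_i; rewrite inE js orbT.
  have /andP [i0 iK] := all_i i (mem_head _ _).
  rewrite /ch -val_eqE /= inordK ?ltnS //.
  by case: i i0 {all_i iK}.
have cg_enc a : map cg (enc a) = map inl (g' a).
  have szK : size (g' a) <= K by exact: (leq_bigmax a).
  rewrite /enc -map_comp.
  have -> : [seq inl i | i <- g' a] =
            [seq (if onth (g' a) i is Some t then inl t else inr (a, ord0))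
             | i <- iota 0 (size (g' a))] :> seq (T + A * 'I_K.+1).
    elim: (g' a) => //= t u IH; congr cons; rewrite IH (iotaDl 1 0) -map_comp.
    by apply: eq_map => i.
  apply/eq_in_map => i; rewrite mem_iota add0n /= => lt_i.
  rewrite inordK; last by lia.
  by have := onthTE (g' a) i; rewrite lt_i; case: (onth _ _).
have iter_ch k : iter k (subst ch) (subst enc w) = subst enc (iter k (subst h') w).
  elim: k => //= k ->; rewrite !subst_comp.
  by congr (flatten _); apply: eq_map => a; rewrite ch_enc.
have cg_subst u : map cg (subst enc u) = map inl (subst g' u).
  by elim: u => //= a u IH; rewrite !subst_cons !map_cat cg_enc IH.
exists (fun u => exists k, u = subst g' (iter k (subst h') w)); split; last split.
- by move=> _ [k ->]; rewrite g'h'.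
- apply: unbounded_infinite_lang => n.
  exists (subst g' (iter n (subst h') w)); first by exists n.
  by rewrite g'h'; apply: leq_trans (long _); nia.
- exists (@CD0LSystem (T + A * 'I_K.+1)%type ch (subst enc w) cg), inl.
  split=> [t t' [] // | v]; split.
    case=> k ->; exists (subst g' (iter k (subst h') w)); split; first by exists k.
    by rewrite /= -cg_subst -iter_ch.
  case=> _ [[k ->] ->]; exists k.
  by rewrite -cg_subst -iter_ch.
Qed.

(** * Affine iterations *)

Definition affine (A : Type) (al : seq A) (h : A -> seq A) (be u : seq A) :=
  al ++ subst h u ++ be.

(* Two marker letters, [h (inr false) = inr false . al] and
   [h (inr true) = be . inr true], turn an affine iteration into a D0L one. *)
Lemma affine_contains_CD0L (A T : finType) (h : A -> seq A) (g : A -> seq T)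
    (al be w : seq A) (x y : seq T) (L : seq T -> Prop) :
  (forall n, L (x ++ subst g (iter n (affine al h be) w) ++ y)) ->
  (forall n, n <= size (subst g (iter n (affine al h be) w))) ->
  exists M : seq T -> Prop,
    (forall u, M u -> L u) /\ infinite_lang M /\ CD0L_language M.
Proof.
move=> inL long.
pose h' (z : A + bool) : seq (A + bool) :=
  match z with
  | inl a => map inl (h a)
  | inr false => inr false :: map inl al
  | inr true => rcons (map inl be) (inr true)
  end.
(* The markers also supply the fixed context [x], [y]. *)
pose g' (z : A + bool) :=
  match z with inl a => g a | inr false => x | inr true => y end.
pose mark (u : seq A) : seq (A + bool) := inr false :: rcons (map inl u) (inr true).
have h'_inl u : subst h' (map inl u) = map inl (subst h u).
  by elim: u => //= a u IH; rewrite !subst_cons map_cat IH.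
have g'_inl u : subst g' (map inl u) = subst g u.
  by elim: u => //= a u IH; rewrite !subst_cons IH.
have h'_mark u : subst h' (mark u) = mark (affine al h be u).
  rewrite /mark subst_cons -!cats1 subst_cat h'_inl subst1 /affine !map_cat /=.
  by rewrite -cats1 -!catA.
have g'_mark u : subst g' (mark u) = x ++ subst g u ++ y.
  by rewrite /mark subst_cons -!cats1 subst_cat g'_inl subst1.
have iter_mark n : iter n (subst h') (mark w) = mark (iter n (affine al h be) w).
  by elim: n => //= n ->.
apply: (@HD0L_contains_CD0L _ _ h' g' (mark w)) => n; rewrite iter_mark g'_mark //.
by rewrite !size_cat; have := long n; lia.
Qed.

(** Used with [n] a yield length and [z] a tree size. *)
Lemma ex_lexmax (P : nat -> nat -> Prop) k :
  (exists n z, P n z) -> (forall n z, P n z -> n <= k) ->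
  exists n z, P n z /\ forall n' z', P n' z' -> n' <= n /\ (n' = n -> z <= z').
Proof.
move=> exP bndP.
pose Q n := `[< exists z, P n z >].
have exQ : exists n, Q n by have [n [z Pnz]] := exP; exists n; apply/asboolP; exists z.
have bndQ n : Q n -> n <= k by move=> /asboolP [z /bndP].
case: (ex_maxnP exQ bndQ) => n /asboolP exz maxn.
have exz' : exists z, `[< P n z >] by have [z Pz] := exz; exists z; apply/asboolP.
case: (ex_minnP exz') => z /asboolP Pnz minz.
exists n, z; split=> // n' z' P'; split.
  by apply: maxn; apply/asboolP; exists z'.
by move=> en; apply: minz; apply/asboolP; rewrite -en.
Qed.

(** * Derivations in context and single steps *)

Section Derivations.

Variables (T : finType) (G : indexed_grammar T).
Notation N := (ig_nt G).
Notation F := (ig_flag G).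
Notation form := (seq (sym N F T)).
Notation cfg := (N * seq F)%type.
Notation derives := (@ig_derives T G).
Notation ter := (map (@Ter N F T)).

Lemma derives_refl l : derives l l.
Proof. exact: rt_refl. Qed.

Lemma derives_trans l2 l1 l3 : derives l1 l2 -> derives l2 l3 -> derives l1 l3.
Proof. exact: rt_trans. Qed.

Lemma derives_ctx x y l1 l2 : derives l1 l2 -> derives (x ++ l1 ++ y) (x ++ l2 ++ y).
Proof.
elim=> [u v uv|u|u v w _ IH1 _ IH2]; [|exact: rt_refl|exact: rt_trans IH2].
apply: rt_step; case: uv => [u' v' X st rhs|u' v' X Y f st|u' v' X f st rhs] R.
- have := step_copy (x ++ u') (v' ++ y) st R.
  by rewrite -!catA /= -?catA.
- have := step_push (x ++ u') (v' ++ y) st R.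
  by rewrite -!catA /= -?catA.
- have := step_pop (x ++ u') (v' ++ y) st R.
  by rewrite -!catA /= -?catA.
Qed.

Lemma derives_cat l1 l2 l1' l2' :
  derives l1 l1' -> derives l2 l2' -> derives (l1 ++ l2) (l1' ++ l2').
Proof.
move=> d1 d2; apply: (@derives_trans (l1' ++ l2)).
  exact: (derives_ctx [::] l2 d1).
by have := derives_ctx l1' [::] d2; rewrite !cats0.
Qed.

Lemma derives_cons x l l' : derives l l' -> derives (x :: l) (x :: l').
Proof. exact: (@derives_cat [:: x] l [:: x] l' (derives_refl _)). Qed.

(** A production without its left-hand side, which the configuration supplies. *)
Inductive act : Type :=
| ACopy of seq (N + T)
| APush of N & F
| APop of seq (N + T).

Definition act_ok (c : cfg) (a : act) : Prop :=
  match a with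
  | ACopy rhs => List.In (RCopy c.1 rhs) (ig_rules G)
  | APush Y f => List.In (RPush c.1 Y f) (ig_rules G)
  | APop rhs => exists f s, c.2 = f :: s /\ List.In (RPop c.1 f rhs) (ig_rules G)
  end.

Definition kids (c : cfg) (a : act) : form :=
  match a with
  | ACopy rhs => expand rhs c.2
  | APush Y f => [:: Nt Y (f :: c.2)]
  | APop rhs => expand rhs (behead c.2)
  end.

Lemma derives_kids c a : act_ok c a -> derives [:: Nt c.1 c.2] (kids c a).
Proof.
case: c => X s; case: a => [rhs|Y f|rhs] /= => [R|R|[f [s' [-> R]]]]; apply: rt_step.
- by have := step_copy [::] [::] s R; rewrite /= cats0.
- exact: (step_push [::] [::] s R).
- by have := step_pop [::] [::] s' R; rewrite /= cats0.
Qed.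

Lemma step_kids l l' : @ig_step T G l l' -> exists u v c a,
  [/\ l = u ++ Nt c.1 c.2 :: v, l' = u ++ kids c a ++ v & act_ok c a].
Proof.
case=> [u v X st rhs|u v X Y f st|u v X f st rhs] R.
- by exists u, v, (X, st), (ACopy rhs).
- by exists u, v, (X, st), (APush Y f).
- by exists u, v, (X, f :: st), (APop rhs); split=> //=; exists f, st.
Qed.

Definition max_arity : nat :=
  foldr (fun r k => maxn k match r with
                           | RCopy _ rhs | RPop _ _ rhs => size rhs
                           | RPush _ _ _ => 1
                           end) 1 (ig_rules G).

Lemma max_arity_gt0 : 0 < max_arity.
Proof. by rewrite /max_arity; elim: (ig_rules G) => //= r s IH; lia. Qed.

Lemma size_kids c a : act_ok c a -> size (kids c a) <= max_arity.
Proof.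
case: a => [rhs|Y f|rhs] /= => [R|_|[f [s [_ R]]]]; rewrite ?size_map.
- move: R; rewrite /max_arity; elim: (ig_rules G) => //= r s IH [-> | /IH]; lia.
- exact: max_arity_gt0.
- move: R; rewrite /max_arity; elim: (ig_rules G) => //= r s' IH [-> | /IH]; lia.
Qed.

(** * Derivation forests *)

(* [big C l w z]: there is a forest of [z] internal nodes, all labelled in [C],
   with roots [l] and terminal yield [w]. *)
Inductive big (C : cfg -> Prop) : form -> seq T -> nat -> Prop :=
| big_nil : big C [::] [::] 0
| big_ter t l w z : big C l w z -> big C (Ter t :: l) (t :: w) z
| big_nt c a l w1 w2 z1 z2 :
    C c -> act_ok c a -> big C (kids c a) w1 z1 -> big C l w2 z2 ->
    big C (Nt c.1 c.2 :: l) (w1 ++ w2) (z1 + z2).+1.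

Lemma big_sub (C C' : cfg -> Prop) l w z :
  (forall c, C c -> C' c) -> big C l w z -> big C' l w z.
Proof.
move=> sub; elim=> {l w z} [|t l w z _ IH|c a l w1 w2 z1 z2 Cc ok _ b1 _ b2].
- exact: big_nil.
- exact: big_ter.
- exact: big_nt (sub _ Cc) ok b1 b2.
Qed.

Lemma big_word C w : big C (ter w) w 0.
Proof. by elim: w => [|t w IH]; [exact: big_nil|exact: big_ter]. Qed.

Lemma big_cat C l1 l2 w1 w2 z1 z2 :
  big C l1 w1 z1 -> big C l2 w2 z2 -> big C (l1 ++ l2) (w1 ++ w2) (z1 + z2).
Proof.
move=> b1 b2; elim: b1 => //= [t l w z _ IH|c a l w w' z z' Cc ok bk _ bl IH].
  exact: big_ter.
by rewrite -catA addSn -addnA; apply: (big_nt (a := a)).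
Qed.

Lemma big_split C l1 l2 w z : big C (l1 ++ l2) w z -> exists w1 w2 z1 z2,
  [/\ big C l1 w1 z1, big C l2 w2 z2, w = w1 ++ w2 & z = z1 + z2].
Proof.
move E: (l1 ++ l2) => l b; elim: b l1 E => {l w z}.
- by case=> //= ->; exists [::], [::], 0, 0; split=> //; exact: big_nil.
- move=> t l w z b IH [|x l1] /= E.
    exists [::], (t :: w), 0, z; split=> //; first exact: big_nil.
    by rewrite E; exact: big_ter.
  case: E => -> /IH [w1 [w2 [z1 [z2 [b1 b2 -> ->]]]]].
  by exists (t :: w1), w2, z1, z2; split=> //; exact: big_ter.
- move=> c a l w1 w2 z1 z2 Cc ok bk _ bl IH [|x l1] /= E.
    exists [::], (w1 ++ w2), 0, (z1 + z2).+1; split=> //; first exact: big_nil.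
    by rewrite E; apply: (big_nt (a := a)).
  case: E => -> /IH [w3 [w4 [z3 [z4 [b3 b4 -> ->]]]]].
  exists (w1 ++ w3), w4, (z1 + z3).+1, z4; split=> //.
  - exact: (big_nt (a := a)).
  - by rewrite catA.
  - by rewrite addSn addnA.
Qed.

Lemma big_nil_inv C w z : big C [::] w z -> w = [::] /\ z = 0.
Proof. by move E: [::] => l b; case: b E. Qed.

Lemma big1_inv C c w z : big C [:: Nt c.1 c.2] w z ->
  exists a z', [/\ C c, act_ok c a, big C (kids c a) w z' & z = z'.+1].
Proof.
move E: [:: _] => l b; case: b E => // c' a l' w1 w2 z1 z2 Cc ok bk bl [e1 e2 El].
have ec : c = c' by case: c c' e1 e2 {Cc ok bk} => ? ? [? ?] /= -> ->.
rewrite -ec in Cc ok bk; rewrite -El in bl.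
have [-> ->] := big_nil_inv bl.
by exists a, z1; rewrite cats0 addn0.
Qed.

Lemma big_nt1 C c a w z :
  C c -> act_ok c a -> big C (kids c a) w z -> big C [:: Nt c.1 c.2] w z.+1.
Proof.
move=> Cc ok bk; have := big_nt Cc ok bk (big_nil C).
by rewrite cats0 addn0.
Qed.

Lemma big_derives C l w z : big C l w z -> derives l (ter w).
Proof.
elim=> {l w z} [|t l w z _ IH|c a l w1 w2 z1 z2 _ ok _ IH1 _ IH2].
- exact: derives_refl.
- exact: derives_cons.
- rewrite map_cat; apply: (derives_cat (l1 := [:: _])) => //.
  exact: derives_trans (derives_kids ok) IH1.
Qed.

Lemma derives_big l w : derives l (ter w) -> exists z, big (fun=> True) l w z.
Proof.
move=> /(clos_rt_rt1n _ _ _ _); move E: (ter w) => l' d.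
elim: d E => {l l'} [l <-|l l1 l2 st _ IH E]; first by exists 0; exact: big_word.
have [z] := IH E; have [u [v [c [a [-> -> ok]]]]] := step_kids st.
move=> /big_split [w1 [w2 [z1 [z2 [b1 /big_split [w3 [w4 [z3 [z4 [b3 b4 -> _]]]]] -> _]]]]].
exists (z1 + (z3 + z4).+1); apply: big_cat b1 _.
exact: (big_nt (a := a)).
Qed.

(** Reachable in a terminal context and productive: a loop at such a configuration can be pumped
    inside words of the language. *)
Definition useful (c : cfg) : Prop := exists u v w,
  derives [:: Nt (ig_start G) [::]] (ter u ++ Nt c.1 c.2 :: ter v) /\
  derives [:: Nt c.1 c.2] (ter w).

(** Going down the tree, the siblings of a node are replaced by their yields, which keeps the
    context terminal. *)
Lemma big_useful C l w z u v :
  big C l w z -> derives [:: Nt (ig_start G) [::]] (ter u ++ l ++ ter v) ->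
  big useful l w z.
Proof.
move=> b; elim: b u v => {l w z} [|t l w z _ IH|c a l w1 w2 z1 z2 _ ok b1 IH1 b2 IH2] u v d.
- exact: big_nil.
- apply: big_ter; apply: (IH (rcons u t) v).
  by rewrite map_rcons -cats1 -catA.
- have d1 := derives_trans (derives_kids ok) (big_derives b1).
  have d2 := big_derives b2.
  apply: (big_nt (a := a)) => //.
  + exists u, (w2 ++ v), w1; split=> //; apply: derives_trans d _.
    rewrite map_cat; apply: derives_cat; first exact: derives_refl.
    by apply: derives_cons; apply: derives_cat d2 _; exact: derives_refl.
  + apply: (IH1 u (w2 ++ v)); apply: derives_trans d _.
    rewrite map_cat; apply: derives_cat; first exact: derives_refl.
    apply: (derives_cat (l1 := [:: _])); first exact: derives_kids.
    by apply: derives_cat d2 _; exact: derives_refl.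
  + apply: (IH2 (u ++ w1) v); apply: derives_trans d _.
    rewrite map_cat -catA; apply: derives_cat; first exact: derives_refl.
    by apply: (derives_cat (l1 := [:: _]) d1); exact: derives_refl.
Qed.

Lemma big_finite C l w z : big C l w z ->
  exists Cl : seq cfg, (forall c, c \in Cl -> C c) /\ big (fun c => c \in Cl) l w z.
Proof.
elim=> {l w z} [|t l w z _ [Cl [sub b]]|c a l w1 w2 z1 z2 Cc ok _ [C1 [s1 b1]] _ [C2 [s2 b2]]].
- by exists [::]; split=> //; exact: big_nil.
- by exists Cl; split=> //; exact: big_ter.
- exists (c :: C1 ++ C2); split.
    move=> d; rewrite inE mem_cat => /orP [/eqP -> // | /orP []]; [exact: s1|exact: s2].
  apply: (big_nt (a := a)) => //; first exact: mem_head.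
    by apply: big_sub b1 => d dC; rewrite inE mem_cat dC orbT.
  by apply: big_sub b2 => d dC; rewrite inE mem_cat dC !orbT.
Qed.

(* Either [c] labels no node, or some occurrence of [c] has no other below it. *)
Lemma big_innermost (C : cfg -> Prop) c l w z : big C l w z ->
  big (fun d => C d /\ d != c) l w z \/
  exists x y w' z' a, [/\ derives l (ter x ++ Nt c.1 c.2 :: ter y), act_ok c a,
    big (fun d => C d /\ d != c) (kids c a) w' z' & w = x ++ w' ++ y].
Proof.
elim=> {l w z} [|t l w z _ IH|d a l w1 w2 z1 z2 Cd ok b1 IH1 b2 IH2].
- by left; exact: big_nil.
- case: IH => [b|[x [y [w' [z' [a [d ok b ->]]]]]]]; first by left; exact: big_ter.
  right; exists (t :: x), y, w', z', a; split=> //; exact: derives_cons.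
- have d1 := derives_kids ok.
  have d2 := big_derives b2.
  case: IH1 => [b1'|[x [y [w' [z' [a' [dx ok' b' ->]]]]]]]; last first.
    right; exists x, (y ++ w2), w', z', a'; split=> //; last by rewrite -!catA.
    have := derives_cat (derives_trans d1 dx) d2.
    by rewrite map_cat -catA.
  case: IH2 => [b2'|[x [y [w' [z' [a' [dx ok' b' ->]]]]]]]; last first.
    right; exists (w1 ++ x), y, w', z', a'; split=> //; last by rewrite -!catA.
    rewrite map_cat -catA; apply: (derives_cat (l1 := [:: _])) dx.
    exact: derives_trans d1 (big_derives b1).
  have [ec|ne] := eqVneq d c; last by left; apply: (big_nt (a := a)).
  rewrite -ec in b1' b2' *; right; exists [::], w2, w1, z1, a; split=> //.
  exact: derives_cons.
Qed.

(** * Bounded yields without pumping loops *)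

Definition no_pumping_loop : Prop := forall c x y, useful c ->
  derives [:: Nt c.1 c.2] (ter x ++ Nt c.1 c.2 :: ter y) -> size x + size y = 0.

(** Below an innermost occurrence of the root configuration [c] there is no [c], and without pumping
    the part above it adds no terminal. So the yield comes from at most [max_arity] roots over fewer
    configurations. *)
Lemma big_bounded (Cl : seq cfg) l w z :
  no_pumping_loop -> (forall c, c \in Cl -> useful c) ->
  big (fun c => c \in Cl) l w z -> size w <= size l * max_arity ^ size Cl.
Proof.
move=> nl; have [n le_n] := ubnP (size Cl).
elim: n Cl l w z le_n => // n IHn Cl l w z le_n us.
have B0 := max_arity_gt0.
elim=> {l w z} [//|t l w z _ IH|c a l w1 w2 z1 z2 Cc ok b1 _ _ IH] /=.
  by rewrite mulSn -add1n; apply: leq_add IH; rewrite expn_gt0 B0.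
rewrite size_cat mulSn; apply: leq_add IH.
have := @big_innermost _ c _ _ _ (big_nt1 Cc ok b1).
case=> [/big1_inv [? [? [[_]]]]|[x [y [w' [z' [a' [dx ok' b' ->]]]]]]]; first by rewrite eqxx.
have sxy := nl _ _ _ (us _ Cc) dx.
rewrite !size_cat; suff: size w' <= max_arity ^ size Cl by lia.
have sCl' : size Cl = (size [seq d <- Cl | d != c] + count_mem c Cl).
  by rewrite size_filter -(count_predC (pred1 c) Cl) addnC; congr (_ + _); apply: eq_count.
have cnt : 0 < count_mem c Cl by rewrite -has_count has_pred1.
apply: leq_trans (IHn [seq d <- Cl | d != c] _ _ z' _ _ _) _; last first.
- rewrite sCl'; case: (count_mem c Cl) cnt => // k _.
  rewrite addnS expnS; apply: leq_mul; first exact: size_kids ok'.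
  by rewrite leq_pexp2l // leq_addr.
- by apply: big_sub b' => d [dC dc]; rewrite mem_filter dc dC.
- by move=> d; rewrite mem_filter => /andP [_ /us].
- rewrite -ltnS; apply: leq_trans le_n; rewrite ltnS sCl'.
  by rewrite -[X in X < _]addn0 ltn_add2l.
Qed.

(** * Strategies choosing one production per configuration *)

Definition on_nt (P : pred cfg) (x : sym N F T) : bool :=
  if x is Nt Y s then P (Y, s) else true.

(** Terminals weigh 1 when yields are measured, 0 when tree nodes are counted. *)
Definition sym_weight (k : nat) (f : cfg -> nat) (x : sym N F T) : nat :=
  if x is Nt Y s then f (Y, s) else k.

(** [m] is a yield length and [r] a tree size, whose strict decrease makes the strategy acyclic. *)
Record strategy (P : pred cfg) (st : cfg -> act) (m r : cfg -> nat) : Prop := {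
  strat_ok : forall c, P c -> act_ok c (st c);
  strat_kids : forall c, P c -> all (on_nt P) (kids c (st c));
  strat_rank : forall c, P c -> sumn (map (sym_weight 0 r) (kids c (st c))) < r c;
  strat_mass : forall c, P c -> m c = sumn (map (sym_weight 1 m) (kids c (st c)));
  strat_yield : forall c, P c -> exists2 w, derives [:: Nt c.1 c.2] (ter w) & size w = m c;
  strat_useful : forall c, P c -> useful c
}.

(** In an optimal tree (longest yield, then fewest nodes) the subtrees can be replaced by optimal
    ones. The yield is already maximal, so its length does not change, and the optimal sizes of the
    children sum to less than that of the parent. *)
Lemma strategy_exists w : no_pumping_loop -> ig_language G w ->
  exists P st m r, [/\ strategy P st m r, P (ig_start G, [::])
                     & size w <= m (ig_start G, [::])].
Proof.
move=> nl /derives_big [z] /(@big_useful _ _ _ _ [::] [::]) /(_ (derives_refl _)).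
move=> /big_finite [Cl [us bw]].
pose bigC := big (fun c => c \in Cl).
pose P (c : cfg) := `[< exists w z, bigC [:: Nt c.1 c.2] w z >].
(* Yields over [Cl] are bounded, so an optimum exists; [(0, 0)] is a dummy value outside [P]. *)
have opt (c : cfg) : exists p : nat * nat, P c ->
    (exists2 v, bigC [:: Nt c.1 c.2] v p.2 & size v = p.1) /\
    forall v k, bigC [:: Nt c.1 c.2] v k -> size v <= p.1 /\ (size v = p.1 -> p.2 <= k).
  case Pc: (P c); last by exists (0, 0).
  have [] := @ex_lexmax (fun n k => exists2 v, bigC [:: Nt c.1 c.2] v k & size v = n)
    (max_arity ^ size Cl).
  - by move/asboolP: Pc => [v [k b]]; exists (size v), k, v.
  - by move=> n k [v /(big_bounded nl us) /= + <-]; rewrite mul1n.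
  move=> n [k [att best]]; exists (n, k) => _; split=> // v k' b.
  by apply: best; exists v.
have [p pP] := choice opt.
pose m c := (p c).1; pose r c := (p c).2.
have att c : P c -> exists2 v, bigC [:: Nt c.1 c.2] v (r c) & size v = m c.
  by move/pP => [].
have best c v k : bigC [:: Nt c.1 c.2] v k -> [/\ P c, size v <= m c & size v = m c -> r c <= k].
  move=> b; have Pc : P c by apply/asboolP; exists v, k.
  by have [_ /(_ _ _ b) []] := pP _ Pc.
have best_form l v k : bigC l v k ->
    [/\ all (on_nt P) l, size v <= sumn (map (sym_weight 1 m) l) &
        size v = sumn (map (sym_weight 1 m) l) -> sumn (map (sym_weight 0 r) l) <= k].
  elim=> {l v k} [//|t l v k _ [al le_m le_r]|c a l v1 v2 k1 k2 Cc ok b1 _ _ [al le_m le_r]].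
    by split=> //= -[/le_r].
  have [Pc le_mc le_rc] := best _ _ _ (big_nt1 Cc ok b1).
  case: c {Cc ok b1} Pc le_mc le_rc => X s Pc le_mc le_rc.
  rewrite /= Pc size_cat; split=> //; first by lia.
  by move=> e; rewrite -addSn; apply: leq_add; [apply: le_rc|apply: le_r]; lia.
have att_form l : all (on_nt P) l ->
    exists2 v, bigC l v (sumn (map (sym_weight 0 r) l)) & size v = sumn (map (sym_weight 1 m) l).
  elim: l => [|[t|Y s] l IH] /=.
  - by exists [::] => //; exact: big_nil.
  - by move=> /IH [v b <-]; exists (t :: v) => //; exact: big_ter.
  - move=> /andP [/att [v1 b1 <-] /IH [v2 b2 <-]].
    exists (v1 ++ v2); last by rewrite size_cat.
    exact: (big_cat b1 b2).
have step (c : cfg) : exists a, P c -> [/\ act_ok c a, all (on_nt P) (kids c a),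
    sumn (map (sym_weight 0 r) (kids c a)) < r c &
    m c = sumn (map (sym_weight 1 m) (kids c a))].
  case Pc: (P c); last by exists (ACopy [::]).
  have [v b ev] := att _ Pc.
  have [a [k [Cc ok bk ek]]] := big1_inv b.
  have [al le_m le_r] := best_form _ _ _ bk.
  have [v' bk' ev'] := att_form _ al.
  (* Optimal subtrees under [a] form a tree for [c], so their yield [v'] is no longer than [m c]. *)
  have [_ le_m' _] := best _ _ _ (big_nt1 Cc ok bk').
  exists a => _; split=> //; last by lia.
  by rewrite ek ltnS; apply: le_r; lia.
have [st stP] := choice step.
exists P, st, m, r; have [P0 le_w _] := best (ig_start G, [::]) _ _ bw.
split=> //; split=> c Pc.
- by have [] := stP _ Pc.
- by have [] := stP _ Pc.
- by have [] := stP _ Pc.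
- by have [] := stP _ Pc.
- by have [v /big_derives d e] := att _ Pc; exists v.
- by have [v /big1_inv [a [k [/us]]]] := att _ Pc.
Qed.

(** The words [u x^n w y^n v] lie in [L]; they are an affine iteration with the identity
    morphism. *)
Lemma pumping_loop_CD0L (L : seq T -> Prop) :
  (forall w, L w <-> ig_language G w) -> ~ no_pumping_loop ->
  exists M : seq T -> Prop,
    (forall u, M u -> L u) /\ infinite_lang M /\ CD0L_language M.
Proof.
move=> LG nl; apply: contrapT => none; apply: nl => c x y [u [v [w [du dw]]]] d.
apply: contrapT => /eqP; rewrite -lt0n => pos; apply: none.
have subst_id (s : seq T) : subst (fun t => [:: t]) s = s.
  by elim: s => //= t s IH; rewrite subst_cons IH.
pose W n := iter n (affine x (fun t => [:: t]) y) w.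
apply: (@affine_contains_CD0L T T (fun t => [:: t]) (fun t => [:: t]) x y w u v) => n;
  rewrite subst_id -/(W n).
- apply/LG; rewrite /ig_language !map_cat.
  apply: derives_trans du _; apply: derives_cat; first exact: derives_refl.
  apply: (derives_cat (l1 := [:: _])); last exact: derives_refl.
  elim: n => // n IH; rewrite /W iterS -/(W n) /affine subst_id.
  apply: derives_trans d _; rewrite !map_cat.
  apply: derives_cat; first exact: derives_refl.
  by apply: (derives_cat (l1 := [:: _])) => //; exact: derives_refl.
- elim: n => // n IH; rewrite /W iterS -/(W n) /affine subst_id !size_cat; lia.
Qed.

End Derivations.

(** * Auxiliary facts on words *)

Lemma all_subst (A B : Type) (p : pred B) (f : A -> seq B) u :
  all p (subst f u) = all (fun a => all p (f a)) u.
Proof. by elim: u => //= a u IH; rewrite subst_cons all_cat IH. Qed.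

Lemma eq_in_subst (A : eqType) (B : Type) (f g : A -> seq B) u :
  {in u, f =1 g} -> subst f u = subst g u.
Proof. by move=> /eq_in_map e; rewrite /subst e. Qed.

Lemma sumn_map_mem (A : eqType) (f : A -> nat) (a : A) u :
  a \in u -> f a <= sumn (map f u).
Proof.
by elim: u => //= b u IH; rewrite inE => /orP [/eqP -> | /IH]; lia.
Qed.

Lemma expand_cat (N F T : Type) (u v : seq (N + T)) (s : seq F) :
  expand (u ++ v) s = expand u s ++ expand v s.
Proof. exact: map_cat. Qed.

(** * Frontiers of a strategy *)

Section Frontier.

Variables (T : finType) (G : indexed_grammar T).
Notation N := (ig_nt G).
Notation F := (ig_flag G).
Notation cfg := (N * seq F)%type.
Notation derives := (@ig_derives T G).
Notation ter := (map (@Ter N F T)).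
Variables (P : pred cfg) (st : cfg -> act G) (m r : cfg -> nat).
Hypothesis strat : strategy P st m r.

Definition is_pop (a : act G) : bool := if a is APop _ then true else false.

Definition on_letter (p : pred N) (x : N + T) : bool :=
  if x is inl Y then p Y else true.

(** Words over [N + T] leave the common stack [s] of their nonterminals implicit; the weight is the
    yield length on that stack. *)
Definition lmass (s : seq F) (x : N + T) : nat :=
  if x is inl Y then m (Y, s) else 1.

Definition mass (s : seq F) (u : seq (N + T)) : nat := sumn (map (lmass s) u).

Definition below (s : seq F) (k : nat) (x : N + T) : bool :=
  on_letter (fun Y => P (Y, s) && (r (Y, s) < k)) x.

Definition good (s : seq F) (x : N + T) : bool :=
  on_letter (fun Y => P (Y, s) && is_pop (st (Y, s))) x.

Lemma strat_copy X s rhs : P (X, s) -> st (X, s) = ACopy rhs ->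
  [/\ List.In (RCopy X rhs) (ig_rules G), all (below s (r (X, s))) rhs
    & mass s rhs = m (X, s)].
Proof.
move=> PX E; have := strat_rank strat PX; have := strat_kids strat PX.
rewrite (strat_mass strat PX); have := strat_ok strat PX; rewrite E /=.
move=> ok ap rk; split=> //; last by rewrite /mass -map_comp; congr sumn; apply: eq_map => -[].
apply/allP => -[Y|//] Yr /=.
move: ap; rewrite all_map => /allP /(_ _ Yr) /= ->.
apply: leq_ltn_trans rk; rewrite -map_comp.
exact: (sumn_map_mem (sym_weight 0 r \o _) Yr).
Qed.

Lemma strat_push X s Y f : P (X, s) -> st (X, s) = APush Y f ->
  [/\ List.In (RPush X Y f) (ig_rules G), P (Y, f :: s),
      r (Y, f :: s) < r (X, s) & m (Y, f :: s) = m (X, s)].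
Proof.
move=> PX E; have := strat_rank strat PX; have := strat_kids strat PX.
rewrite (strat_mass strat PX); have := strat_ok strat PX; rewrite E /=.
by rewrite andbT !addn0.
Qed.

Lemma strat_pop X f s rhs : P (X, f :: s) -> st (X, f :: s) = APop rhs ->
  [/\ List.In (RPop X f rhs) (ig_rules G), all (below s (r (X, f :: s))) rhs
    & mass s rhs = m (X, f :: s)].
Proof.
move=> PX E; have := strat_rank strat PX; have := strat_kids strat PX.
rewrite (strat_mass strat PX); have := strat_ok strat PX; rewrite E /=.
move=> [f' [s' [[-> ->] ok]]] ap rk; split=> //.
  apply/allP => -[Y|//] Yr /=.
  move: ap; rewrite all_map => /allP /(_ _ Yr) /= ->.
  apply: leq_ltn_trans rk; rewrite -map_comp.
  exact: (sumn_map_mem (sym_weight 0 r \o _) Yr).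
by rewrite /mass -map_comp; congr sumn; apply: eq_map => -[].
Qed.

(** Effect of the chosen pop; [[::]] is a dummy value, never met on good letters. *)
Definition pop_letter (s : seq F) (x : N + T) : seq (N + T) :=
  match x with
  | inl Z => if st (Z, s) is APop rhs then rhs else [::]
  | inr t => [:: inr t]
  end.

Lemma good_inl_pop f s Z : good (f :: s) (inl Z) ->
  exists rhs, [/\ st (Z, f :: s) = APop rhs, P (Z, f :: s),
    List.In (RPop Z f rhs) (ig_rules G),
    all (below s (r (Z, f :: s))) rhs & mass s rhs = m (Z, f :: s)].
Proof.
move=> /andP [PZ]; case E: (st _) => [||rhs] // _.
by have [] := strat_pop PZ E; exists rhs.
Qed.

(** The recursion follows the rank [r], hence the fuel. After a push, the frontier above the new
    flag is computed, each of its letters pops the flag, and frontiers over [s] are taken again. *)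
Fixpoint frontier_fuel (k : nat) (X : N) (s : seq F) : seq (N + T) :=
  if k is k'.+1 then
    let fl x := match x with
                | inl Y => frontier_fuel k' Y s
                | inr t => [:: inr t]
                end in
    match st (X, s) with
    | APop _ => [:: inl X]
    | ACopy rhs => subst fl rhs
    | APush Y f => subst fl (subst (pop_letter (f :: s)) (frontier_fuel k' Y (f :: s)))
    end
  else [::].

Definition fuel_letter (k : nat) (s : seq F) (x : N + T) : seq (N + T) :=
  match x with inl Y => frontier_fuel k Y s | inr t => [:: inr t] end.

Lemma frontier_fuel_rec k X s : frontier_fuel k.+1 X s =
  match st (X, s) with
  | APop _ => [:: inl X]
  | ACopy rhs => subst (fuel_letter k s) rhs
  | APush Y f => subst (fuel_letter k s)
                   (subst (pop_letter (f :: s)) (frontier_fuel k Y (f :: s)))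
  end.
Proof. by []. Qed.

Lemma below_weaken s k k' x : k <= k' -> below s k x -> below s k' x.
Proof. by move=> le_k; case: x => [Y|t] //= /andP [-> /=]; lia. Qed.

Lemma pop_letter_below f s k x :
  good (f :: s) x && below (f :: s) k.+1 x -> all (below s k) (pop_letter (f :: s) x).
Proof.
case: x => [Z|t] //= /andP [/good_inl_pop [rhs [E PZ _ ab _]] /andP [_ lt_r]].
by rewrite E; apply: sub_all ab => x; apply: below_weaken.
Qed.

Lemma frontier_fuel_below k X s : P (X, s) ->
  all (fun x => good s x && below s (r (X, s)).+1 x) (frontier_fuel k X s).
Proof.
elim: k X s => //= k IH X s PX; case E: (st _) => [rhs|Y f|rhs].
- have [_ ab _] := strat_copy PX E.
  rewrite all_subst; apply: sub_all ab => -[Y|//] /= /andP [PY lt_r].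
  apply: sub_all (IH _ _ PY) => x /andP [-> /=].
  by apply: below_weaken; exact: ltnW.
- have [_ PY lt_r _] := strat_push PX E.
  rewrite !all_subst; apply: sub_all (IH _ _ PY) => z /pop_letter_below.
  apply: sub_all => -[W|//] /= /andP [PW lt_W].
  apply: sub_all (IH _ _ PW) => x /andP [-> /=].
  by apply: below_weaken; lia.
- by rewrite /= PX E ltnS leqnn.
Qed.

(** Every recursive call concerns a smaller rank, so fuel above the rank of [X] is never
    exhausted. *)
Lemma frontier_fuelS k X s : P (X, s) -> r (X, s) < k ->
  frontier_fuel k.+1 X s = frontier_fuel k X s.
Proof.
elim: k X s => // k IH X s PX; rewrite ltnS => le_k.
rewrite [LHS]frontier_fuel_rec [RHS]frontier_fuel_rec; case E: (st _) => [rhs|Y f|//].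
  have [_ /allP ab _] := strat_copy PX E.
  apply: eq_in_subst => -[Y|//] /ab /andP [PY lt_r].
  by apply: IH => //; apply: leq_trans le_k.
have [_ PY lt_r _] := strat_push PX E.
rewrite IH //; last by lia.
have := frontier_fuel_below k PY; move: (frontier_fuel k Y _) => u /allP au.
rewrite !subst_comp; apply: eq_in_subst => z /au /pop_letter_below /allP az.
apply: eq_in_subst => -[W|//] /az /andP [PW lt_W].
by apply: IH => //; lia.
Qed.

(* The word over pop-ready nonterminals and terminals into which the strategy
   rewrites [X] on stack [s] before touching [s]. *)
Definition frontier (X : N) (s : seq F) : seq (N + T) :=
  frontier_fuel (r (X, s)).+1 X s.

Lemma frontier_fuelE k X s : P (X, s) -> r (X, s) < k ->
  frontier_fuel k X s = frontier X s.
Proof.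
move=> PX lt_k; rewrite /frontier -(subnKC lt_k).
by elim: (k - _) => [|j IH]; rewrite ?addn0 // addnS frontier_fuelS ?ltn_addr.
Qed.

Definition frontier_letter (s : seq F) (x : N + T) : seq (N + T) :=
  match x with inl Y => frontier Y s | inr t => [:: inr t] end.

(** The first word over [s] itself: one copy, or one push followed by the pops of the pushed flag.
    The value for a pop is a dummy. *)
Definition unroll (X : N) (s : seq F) : seq (N + T) :=
  match st (X, s) with
  | ACopy rhs => rhs
  | APush Y f => subst (pop_letter (f :: s)) (frontier Y (f :: s))
  | APop _ => [::]
  end.

Lemma frontier_below X s : P (X, s) ->
  all (fun x => good s x && below s (r (X, s)).+1 x) (frontier X s).
Proof. exact: frontier_fuel_below. Qed.

Lemma frontier_good X s : P (X, s) -> all (good s) (frontier X s).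
Proof. by move=> /frontier_below; apply: sub_all => x /andP []. Qed.

Lemma frontier_pop X s : is_pop (st (X, s)) -> frontier X s = [:: inl X].
Proof. by rewrite /frontier /=; case: (st _). Qed.

Lemma unroll_below X s : P (X, s) -> all (below s (r (X, s))) (unroll X s).
Proof.
move=> PX; rewrite /unroll; case E: (st _) => [rhs|Y f|//].
  by have [] := strat_copy PX E.
have [_ PY lt_r _] := strat_push PX E.
rewrite all_subst; apply: sub_all (frontier_below PY) => z /pop_letter_below.
by apply: sub_all => x; apply: below_weaken; exact: ltnW.
Qed.

Lemma frontier_unroll X s : P (X, s) -> ~~ is_pop (st (X, s)) ->
  frontier X s = subst (frontier_letter s) (unroll X s).
Proof.
move=> PX np; have := unroll_below PX.
rewrite {1}/frontier frontier_fuel_rec /unroll; case E: (st _) np => [rhs|Y f|//] _ /allP ab.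
  apply: eq_in_subst => -[Y|//] /ab /= /andP [PY lt_r].
  exact: frontier_fuelE.
have [_ PY lt_r _] := strat_push PX E.
rewrite frontier_fuelE //; apply: eq_in_subst => -[W|//] /ab /= /andP [PW lt_W].
exact: frontier_fuelE.
Qed.

Lemma strat_ind (Q : N -> seq F -> Prop) :
  (forall X s, P (X, s) ->
     (forall Y s', P (Y, s') -> r (Y, s') < r (X, s) -> Q Y s') -> Q X s) ->
  forall X s, P (X, s) -> Q X s.
Proof.
move=> step X s; have [n] := ubnP (r (X, s)).
elim: n X s => // n IH X s le_n PX; apply: step => // Y s' PY lt_r.
by apply: IH => //; lia.
Qed.

Lemma mass_cat s u v : mass s (u ++ v) = mass s u + mass s v.
Proof. by rewrite /mass map_cat sumn_cat. Qed.

Lemma mass_subst s s' (f : N + T -> seq (N + T)) u :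
  {in u, forall x, mass s (f x) = lmass s' x} -> mass s (subst f u) = mass s' u.
Proof.
elim: u => //= x u IH fP; rewrite subst_cons mass_cat fP ?mem_head // IH //.
by move=> y yu; apply: fP; rewrite inE yu orbT.
Qed.

Lemma mass_pop_letter f s x :
  good (f :: s) x -> mass s (pop_letter (f :: s) x) = lmass (f :: s) x.
Proof. by case: x => [Z|t] // /good_inl_pop [rhs [/= -> _ _ _ ->]]. Qed.

Lemma mass_frontier X s : P (X, s) -> mass s (frontier X s) = m (X, s).
Proof.
move: X s; apply: strat_ind => X s PX IH.
have [pop|npop] := boolP (is_pop (st (X, s))).
  by rewrite frontier_pop // /mass /= addn0.
rewrite frontier_unroll //.
rewrite (@mass_subst s s); last first.
  move=> -[Y|//] /(allP (unroll_below PX)) /= /andP [PY lt_r]; exact: IH.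
rewrite /unroll; case E: (st _) npop => [rhs|Y f|//] _.
  by have [] := strat_copy PX E.
have [_ PY lt_r <-] := strat_push PX E.
rewrite -IH //; apply: mass_subst => x /(allP (frontier_good PY)).
exact: mass_pop_letter.
Qed.

Lemma mass_frontier_letter s x k : below s k x -> mass s (frontier_letter s x) = lmass s x.
Proof. by case: x => [Y|//] /= /andP [PY _]; exact: mass_frontier. Qed.

Lemma derives_subst (f : N + T -> seq (N + T)) u (b b' : seq F) :
  {in u, forall x, derives (expand [:: x] b') (expand (f x) b)} ->
  derives (expand u b') (expand (subst f u) b).
Proof.
elim: u => [_|x u IH fP]; first exact: derives_refl.
rewrite subst_cons expand_cat; apply: (derives_cat (l1 := [:: _])).
  exact: (fP x (mem_head _ _)).
by apply: IH => y yu; apply: fP; rewrite inE yu orbT.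
Qed.

Lemma derives_pop_letter f s x b : good (f :: s) x ->
  derives (expand [:: x] (f :: b)) (expand (pop_letter (f :: s) x) b).
Proof.
case: x => [Z|t] /=; last by move=> _; exact: derives_refl.
move=> /good_inl_pop [rhs [-> _ R _ _]].
by apply: (@derives_kids _ _ (Z, f :: b) (APop rhs)); exists f, b.
Qed.

(** The claim for smaller ranks is a premise, since this is a step of the induction for
    [derives_frontier]. *)
Lemma derives_unroll_aux X s b : P (X, s) -> ~~ is_pop (st (X, s)) ->
  (forall Y s', P (Y, s') -> r (Y, s') < r (X, s) ->
     forall b, derives [:: Nt Y b] (expand (frontier Y s') b)) ->
  derives [:: Nt X b] (expand (unroll X s) b).
Proof.
move=> PX npop IH; rewrite /unroll; case E: (st _) npop => [rhs|Y f|//] _.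
  have [R _ _] := strat_copy PX E.
  exact: (@derives_kids _ _ (X, b) (ACopy rhs)).
have [R PY lt_r _] := strat_push PX E.
apply: derives_trans (@derives_kids _ _ (X, b) (APush Y f) R) _.
apply: derives_trans (IH _ _ PY lt_r (f :: b)) _.
apply: derives_subst => x /(allP (frontier_good PY)).
exact: derives_pop_letter.
Qed.

(** The stack [s] guides the choices but is not touched before the frontier, so the same productions
    apply above any stack [b]. *)
Lemma derives_frontier X s : P (X, s) ->
  forall b, derives [:: Nt X b] (expand (frontier X s) b).
Proof.
move: X s; apply: strat_ind => X s PX IH b.
have [pop|npop] := boolP (is_pop (st (X, s))).
  by rewrite frontier_pop //; exact: derives_refl.
rewrite frontier_unroll //; apply: derives_trans (derives_unroll_aux b PX npop IH) _.
apply: derives_subst => -[Y|t] /(allP (unroll_below PX)) /=.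
  by move=> /andP [PY lt_r]; exact: IH.
by move=> _; exact: derives_refl.
Qed.

Lemma derives_unroll X s b : P (X, s) -> ~~ is_pop (st (X, s)) ->
  derives [:: Nt X b] (expand (unroll X s) b).
Proof.
by move=> PX npop; apply: derives_unroll_aux => // Y s' PY _; exact: derives_frontier.
Qed.

Lemma derives_frontier_letter s x k b :
  below s k x -> derives (expand [:: x] b) (expand (frontier_letter s x) b).
Proof.
case: x => [Y|t] /=; last by move=> _; exact: derives_refl.
by move=> /andP [PY _]; exact: derives_frontier.
Qed.

Lemma frontier_letter_good s x k : below s k x -> all (good s) (frontier_letter s x).
Proof. by case: x => [Y|//] /= /andP [PY _]; exact: frontier_good. Qed.

(** * Live letters: those with nonempty yield *)

Definition live (s : seq F) (x : N + T) : bool := 0 < lmass s x.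

Definition nlive (s : seq F) (u : seq (N + T)) : nat := count (live s) u.

Lemma nlive_cat s u v : nlive s (u ++ v) = nlive s u + nlive s v.
Proof. exact: count_cat. Qed.

Lemma nlive_eq0 s u : (nlive s u == 0) = (mass s u == 0).
Proof. by elim: u => //= x u; rewrite /mass /= !addn_eq0 => ->; rewrite /live; lia. Qed.

Lemma nlive_subst_ge s s' (f : N + T -> seq (N + T)) u :
  {in u, forall x, mass s (f x) = lmass s' x} -> nlive s' u <= nlive s (subst f u).
Proof.
elim: u => //= x u IH fP; rewrite subst_cons nlive_cat.
apply: leq_add; last by apply: IH => y yu; apply: fP; rewrite inE yu orbT.
have := nlive_eq0 s (f x); rewrite fP ?mem_head // /live; lia.
Qed.

(** Dead letters have images of mass zero, so only live letters contribute. *)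
Lemma nlive_subst_le s s' (f : N + T -> seq (N + T)) u k :
  {in u, forall x, mass s (f x) = lmass s' x} ->
  {in u, forall x, nlive s (f x) <= k} -> nlive s (subst f u) <= nlive s' u * k.
Proof.
elim: u => //= x u IH fP fk; rewrite subst_cons nlive_cat mulnDl.
apply: leq_add; last first.
  by apply: IH => y yu; [apply: fP|apply: fk]; rewrite inE yu orbT.
have := nlive_eq0 s (f x); rewrite fP ?mem_head // /live.
case: (lmass s' x) => [|n] /=; first by move=> /eqP ->.
by rewrite mul1n fk ?mem_head.
Qed.

(** * Links between configurations *)

(** [c] reaches [d] with the segment [v] pushed, leaving [al] and [be] on the two sides; [h] is the
    net effect of popping [v]. The derivations hold above every [b], which lets links compose and
    iterate. *)
Record link_data (c d : cfg) (v : seq F) (al be : seq (N + T))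
    (h : N + T -> seq (N + T)) : Prop := {
  link_derives : forall b,
    derives [:: Nt c.1 b] (expand al b ++ Nt d.1 (v ++ b) :: expand be b);
  link_frontier : frontier c.1 c.2 = affine al h be (frontier d.1 d.2);
  link_good_l : all (good c.2) al;
  link_good_r : all (good c.2) be;
  link_hder : forall x b, good d.2 x ->
    derives (expand [:: x] (v ++ b)) (expand (h x) b);
  link_hgood : forall x, good d.2 x -> all (good c.2) (h x);
  link_hmass : forall x, good d.2 x -> mass c.2 (h x) = lmass d.2 x
}.

Definition link (c d : cfg) : Prop := exists v al be h, link_data c d v al be h.

(** Affine maps compose: the inner side words [al2], [be2] pass through [h1]. *)
Lemma link_trans c d e : link c d -> link d e -> link c e.
Proof.
move=> [v1 [al1 [be1 [h1 l1]]]] [v2 [al2 [be2 [h2 l2]]]].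
have gl2 := allP (link_good_l l2); have gr2 := allP (link_good_r l2).
exists (v2 ++ v1), (al1 ++ subst h1 al2), (subst h1 be2 ++ be1),
  (fun x => subst h1 (h2 x)); split.
- move=> b; apply: derives_trans (link_derives l1 b) _.
  rewrite !expand_cat -catA; apply: derives_cat; first exact: derives_refl.
  rewrite -cat1s -cat_cons catA; apply: derives_cat; last exact: derives_refl.
  apply: derives_trans (link_derives l2 (v1 ++ b)) _.
  rewrite -catA; apply: derives_cat.
    by apply: derives_subst => x /gl2 gx; exact: link_hder l1 _ _ gx.
  apply: derives_cons.
  by apply: derives_subst => x /gr2 gx; exact: link_hder l1 _ _ gx.
- rewrite (link_frontier l1) (link_frontier l2) /affine !subst_cat subst_comp.
  by rewrite -!catA.
- rewrite all_cat (link_good_l l1) all_subst /=.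
  by apply/allP => x /gl2; exact: link_hgood l1 _.
- rewrite all_cat (link_good_r l1) all_subst andbT.
  by apply/allP => x /gr2; exact: link_hgood l1 _.
- move=> x b gx; rewrite -catA.
  apply: derives_trans (link_hder l2 (v1 ++ b) gx) _.
  by apply: derives_subst => y /(allP (link_hgood l2 gx)); exact: link_hder l1 _ _.
- move=> x gx; rewrite all_subst; apply/allP => y /(allP (link_hgood l2 gx)).
  exact: link_hgood l1 _.
- move=> x gx; rewrite -(link_hmass l2 gx); apply: mass_subst => y.
  by move=> /(allP (link_hgood l2 gx)); exact: link_hmass l1 _.
Qed.

Lemma link_push X s Y f : P (X, s) -> st (X, s) = APush Y f ->
  link (X, s) (Y, f :: s).
Proof.
move=> PX E; have [R PY lt_r _] := strat_push PX E.
have pb x : good (f :: s) x ->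
    exists k, all (below s k) (pop_letter (f :: s) x).
  (* A nonterminal is bounded by its own rank; any value serves for a terminal. *)
  move=> gx; exists (r (if x is inl Z then (Z, f :: s) else (X, s))).
  apply: pop_letter_below; rewrite gx.
  by case: x gx => [Z|//] /andP [PZ _] /=; rewrite PZ ltnS leqnn.
exists [:: f], [::], [::], (fun x => subst (frontier_letter s) (pop_letter (f :: s) x)).
split=> //=.
- by move=> b; exact: (@derives_kids _ _ (X, b) (APush Y f) R).
- by rewrite frontier_unroll ?E // /unroll E /affine subst_comp cats0.
- move=> x b gx; apply: derives_trans (derives_pop_letter b gx) _.
  have [k /allP ab] := pb x gx.
  by apply: derives_subst => y /ab; exact: derives_frontier_letter.
- move=> x gx; have [k ab] := pb x gx.
  rewrite all_subst; apply: sub_all ab => y; exact: frontier_letter_good.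
- move=> x gx; rewrite -(mass_pop_letter gx).
  have [k /allP ab] := pb x gx; apply: mass_subst => y /ab.
  exact: mass_frontier_letter.
Qed.

(** The stack is unchanged, so [v] is empty and [h] is the identity; the frontiers of the neighbours
    of [Z] form [al] and [be]. *)
Lemma link_unroll X s Z : P (X, s) -> ~~ is_pop (st (X, s)) ->
  inl Z \in unroll X s -> link (X, s) (Z, s).
Proof.
move=> PX npop /splitPr E; have := unroll_below PX; have := fun b => derives_unroll b PX npop.
have := frontier_unroll PX npop; case: E => u v Ef der.
rewrite all_cat /= => /and3P [au _ av].
exists [::], (subst (frontier_letter s) u), (subst (frontier_letter s) v),
  (fun x => [:: x]); split=> /=.
- move=> b; apply: derives_trans (der b) _; rewrite expand_cat.
  apply: derives_cat; last apply: derives_cons.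
    by apply: derives_subst => x /(allP au); exact: derives_frontier_letter.
  by apply: derives_subst => x /(allP av); exact: derives_frontier_letter.
- rewrite Ef subst_cat subst_cons /affine /=; congr (_ ++ (_ ++ _)).
  by elim: (frontier Z s) => //= x w {1}->.
- rewrite all_subst; apply: sub_all au => x; exact: frontier_letter_good.
- rewrite all_subst; apply: sub_all av => x; exact: frontier_letter_good.
- by move=> x b _; exact: derives_refl.
- by move=> x ->.
- by move=> x _; rewrite /mass /= addn0.
Qed.

(** [h] sends each live letter to a word with a live letter, and [al], [be] can only add more. *)
Lemma link_nlive c d : P d -> link c d ->
  nlive d.2 (frontier d.1 d.2) <= nlive c.2 (frontier c.1 c.2).
Proof.
case: d => Y s' PY [v [al [be [h l]]]].
rewrite (link_frontier l) /affine !nlive_cat.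
apply: leq_trans (leq_addl _ _); apply: leq_trans (leq_addr _ _).
apply: nlive_subst_ge => x /(allP (frontier_good PY)) gx.
exact: (link_hmass l gx).
Qed.

(** * Many live letters force a link to a higher stack *)

(** Bounds the nesting of unrollings on a fixed stack, and is at most [#|N|] however large the ranks
    are. *)
Definition level_rank (X : N) (s : seq F) : nat :=
  #|[set Z : N | P (Z, s) && (r (Z, s) <= r (X, s))]|.

Lemma level_rank_lt X Y s : P (X, s) -> r (Y, s) < r (X, s) ->
  level_rank Y s < level_rank X s.
Proof.
move=> PX lt_r; apply: proper_card; apply/properP; split.
  by apply/subsetP => Z; rewrite !inE => /andP [->] /=; lia.
by exists X; rewrite !inE PX ?leqnn //= -ltnNge.
Qed.

Lemma nlive_unroll_le X s R : 0 < R -> P (X, s) ->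
  (forall Y f, st (X, s) = APush Y f -> nlive (f :: s) (frontier Y (f :: s)) <= R) ->
  nlive s (unroll X s) <= max_arity G * R.
Proof.
move=> R0 PX; have := size_kids (strat_ok strat PX).
rewrite /unroll; case E: (st _) => [rhs|Y f|//] /= sz HR.
  apply: leq_trans (count_size _ _) _; move: sz; rewrite size_map => sz.
  by apply: leq_trans sz _; rewrite leq_pmulr.
have [_ PY _ _] := strat_push PX E.
apply: leq_trans (@nlive_subst_le s (f :: s) _ _ (max_arity G) _ _) _.
- by move=> x /(allP (frontier_good PY)); exact: mass_pop_letter.
- move=> [Z|t] /(allP (frontier_good PY)); last by move=> _; exact: max_arity_gt0.
  move=> /good_inl_pop [rhs [EZ PZ _ _ _]] /=; rewrite EZ.
  apply: leq_trans (count_size _ _) _.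
  by have := size_kids (strat_ok strat PZ); rewrite EZ /= size_map.
- by rewrite mulnC leq_mul2l HR ?orbT.
Qed.

(** If no push met over [s] leads to more than [R] live letters, each unrolling multiplies their
    number by at most [max_arity G * R], and the nesting is bounded by [level_rank X s]. Otherwise
    the links of the unrollings compose with that of the push. *)
Lemma nlive_frontier_or_link R X s : 0 < R -> P (X, s) ->
  nlive s (frontier X s) <= (max_arity G * R) ^ level_rank X s \/
  exists Y f, [/\ P (Y, f :: s), r (Y, f :: s) < r (X, s),
    R < nlive (f :: s) (frontier Y (f :: s)) & link (X, s) (Y, f :: s)].
Proof.
move=> R0; move: X s; apply: strat_ind => X s PX IH.
have K0 : 0 < max_arity G * R by rewrite muln_gt0 max_arity_gt0.
have [pop|npop] := boolP (is_pop (st (X, s))).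
  left; rewrite frontier_pop //; apply: leq_trans (count_size _ _) _.
  by rewrite expn_gt0 K0.
apply: contrapT => /not_orP [big none]; apply: big.
rewrite frontier_unroll //.
have rank0 : 0 < level_rank X s.
  by rewrite card_gt0; apply/set0Pn; exists X; rewrite inE PX leqnn.
rewrite -(prednK rank0) expnS.
apply: leq_trans (@nlive_subst_le s s _ _ ((max_arity G * R) ^ (level_rank X s).-1) _ _) _.
- move=> x /(allP (unroll_below PX)); exact: mass_frontier_letter.
- move=> [Z|t] Zu; last first.
    by apply: leq_trans (count_size _ _) _; rewrite expn_gt0 K0.
  have /andP [PZ lt_r] := allP (unroll_below PX) _ Zu.
  have [le_n|[Y [f [PY lt_Y big lk]]]] := IH _ _ PZ lt_r.
    apply: leq_trans le_n _; rewrite leq_pexp2l //.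
    by have := level_rank_lt PX lt_r; lia.
  case: none; exists Y, f; split=> //; first by lia.
  exact: link_trans (link_unroll PX npop Zu) lk.
- rewrite leq_mul2r nlive_unroll_le ?orbT // => Y f E.
  rewrite leqNgt; apply/negP => big; apply: none; exists Y, f.
  have [_ PY lt_r _] := strat_push PX E.
  by split=> //; exact: link_push.
Qed.

(** * Colours and the descent *)

(** Finite data that must agree at both ends of a link for its iteration to stay good and to
    grow. *)
Definition color (c : cfg) :=
  (c.1, [set x | good c.2 x], [set x | live c.2 x],
   [set x in frontier c.1 c.2 | live c.2 x]).

(** Iterates the bound of [nlive_frontier_or_link], with [level_rank] estimated by [#|N|]: exceeding
    [threshold n.+1] gives a link to a frontier exceeding [threshold n]. *)
Fixpoint threshold (n : nat) : nat :=
  if n is n'.+1 then (max_arity G * threshold n') ^ #|N| else 1.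

Lemma threshold_gt0 n : 0 < threshold n.
Proof. by elim: n => //= n IH; rewrite expn_gt0 muln_gt0 max_arity_gt0 IH. Qed.

Definition descends (c d : cfg) : Prop :=
  link c d /\ nlive d.2 (frontier d.1 d.2) < nlive c.2 (frontier c.1 c.2).

(* [U] is the set of colours already met along the chain of links leading to
   [(X, s)]; each strict descent adds a new colour or closes a pumpable pair. *)
Lemma descent_repeats_color n (U : {set _}) X s :
  P (X, s) -> #|~: U| <= n -> threshold n < nlive s (frontier X s) ->
  (forall u, u \in U -> exists c, [/\ P c, color c = u & descends c (X, s)]) ->
  exists c d, [/\ P c, P d, color c = color d & descends c d].
Proof.
elim: n U X s => [|n IHn] U; apply: strat_ind => X s PX IHr leU big chain.
  have /chain [c [Pc e lk]] : color (X, s) \in U.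
    by move: leU; rewrite leqn0 cards_eq0 => /eqP U0; rewrite -[U]setCK U0 setC0 inE.
  by exists c, (X, s).
have [/chain [c [Pc e lk]]|nU] := boolP (color (X, s) \in U).
  by exists c, (X, s).
have [le_n|[Y [f [PY lt_r bigY lk]]]] := nlive_frontier_or_link (threshold_gt0 n) PX.
  have : nlive s (frontier X s) <= threshold n.+1.
    apply: leq_trans le_n _; apply: leq_pexp2l; last exact: max_card.
    by rewrite muln_gt0 max_arity_gt0 threshold_gt0.
  by rewrite leqNgt big.
have mono := link_nlive PY lk.
(* If the count drops, the current colour joins [U] and [n] decreases; otherwise [U] and [n] are
   kept and the induction on the rank applies. *)
have [lt_n|ge_n] := ltnP (nlive (f :: s) (frontier Y (f :: s))) (nlive s (frontier X s)).
  apply: (IHn (color (X, s) |: U) _ _ PY _ bigY).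
    rewrite -ltnS; apply: leq_trans leU; apply: proper_card.
    apply/properP; split; first by rewrite setCS subsetUr.
    by exists (color (X, s)); rewrite !inE ?eqxx // nU.
  move=> u; rewrite in_setU1 => /orP [/eqP -> | /chain [c [Pc e [lc dc]]]].
    by exists (X, s); split.
  by exists c; split=> //; split; [exact: link_trans lc lk|exact: leq_trans dc].
apply: (IHr _ _ PY lt_r leU (leq_trans big ge_n)) => u /chain [c [Pc e [lc dc]]].
exists c; split=> //; split; [exact: link_trans lc lk|exact: leq_ltn_trans dc].
Qed.

(** Both ends share the nonterminal [X], so the link can be iterated from [frontier X s'], and every
    [W n] is evaluated on the stack [s]. Equal colours keep the set of live letters constant; the
    strict descent then makes their number grow at each step. *)
Lemma descends_same_color_CD0L (L : seq T -> Prop) c d :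
  (forall w, L w <-> ig_language G w) ->
  P c -> P d -> color c = color d -> descends c d ->
  exists M : seq T -> Prop,
    (forall u, M u -> L u) /\ infinite_lang M /\ CD0L_language M.
Proof.
case: c d => X s [Y s'] LG Pc Pd [eX /setP eg /setP el /setP eD].
move=> [[v [al [be [h l]]]] /= lt_n]; rewrite -eX {Y eX} in Pd l lt_n eD.
have {}eg x : good s' x = good s x by have := eg x; rewrite !inE.
have {}el x : live s' x = live s x by have := el x; rewrite !inE.
pose W n := iter n (affine al h be) (frontier X s').
have W1 : W 1 = frontier X s by rewrite (link_frontier l).
have hmass x : good s x -> mass s (h x) = lmass s' x.
  by rewrite -eg => gx; exact: (link_hmass l gx).
have Wgood n : all (good s) (W n).
  elim: n => [|n IH].
    by apply: sub_all (frontier_good Pd) => x; rewrite eg.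
  rewrite /W iterS -/(W n) /affine !all_cat (link_good_l l) (link_good_r l) andbT /=.
  rewrite all_subst; apply: sub_all IH => x; rewrite -eg => gx.
  exact: (link_hgood l gx).
(* The link returns to [X] above [v ++ b], where the induction hypothesis applies; [h] then pops
   [v]. *)
have Wder n b : derives [:: Nt X b] (expand (W n) b).
  elim: n b => [|n IH] b; first exact: (derives_frontier Pd b).
  rewrite /W iterS -/(W n) /affine !expand_cat.
  apply: derives_trans (link_derives l b) _.
  apply: derives_cat; first exact: derives_refl.
  apply: (derives_cat (l1 := [:: _])); last exact: derives_refl.
  apply: derives_trans (IH (v ++ b)) _.
  apply: derives_subst => x /(allP (Wgood n)); rewrite -eg => gx.
  exact: (link_hder l b gx).
have hlive x y : good s x -> y \in h x -> live s y -> live s x.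
  move=> gx yh ly; rewrite -el /live -hmass //.
  apply: leq_trans (sumn_map_mem _ yh); exact: ly.
(* Live letters of [W n.+1] come from [al], [be] or live letters of [W n]; equal colours settle
   [W 0] against [W 1]. *)
have Wlive n x : live s x -> (x \in W n) = (x \in W 0).
  elim: n x => // n IH x lx.
  have -> : (x \in W 0) = (x \in W 1).
    by have := eD x; rewrite W1 !inE el lx !andbT => ->.
  rewrite /W iterS -/(W n) /= -[frontier X s']/(W 0) /affine !mem_cat.
  congr (_ || (_ || _)); apply/flatten_mapP/flatten_mapP => -[z zW xz].
    by exists z => //; rewrite -IH //; apply: (hlive _ _ _ xz lx); apply: (allP (Wgood n)).
  by exists z => //; rewrite IH //; apply: (hlive _ _ _ xz lx); apply: (allP (Wgood 0)).
have hge x : good s x -> live s x <= nlive s (h x).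
  move=> gx; have := nlive_eq0 s (h x); rewrite hmass // -el /live; lia.
have Wgrow n : nlive s (W n) < nlive s (W n.+1).
  have sub_ge u : all (good s) u -> nlive s u <= nlive s (subst h u).
    elim: u => //= x u IH /andP [gx /IH le_u]; rewrite subst_cons nlive_cat.
    exact: leq_add (hge x gx) le_u.
  rewrite /W iterS -/(W n) /affine !nlive_cat.
  have := sub_ge _ (Wgood n); rewrite leq_eqVlt => /orP [/eqP eqn|]; last by lia.
  suff: 0 < nlive s al + nlive s be by lia.
  (* No live letter of [W n] is duplicated by [h], and [W 0] has the same
     live letters, so its growth must come from [al] and [be]. *)
  have h1 x : x \in W n -> nlive s (h x) = live s x.
    move: eqn (Wgood n); elim: (W n) => //= y u IH; rewrite subst_cons nlive_cat.
    move=> eqn /andP [gy gu]; have := hge y gy; have := sub_ge u gu.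
    rewrite inE => le_u le_y /orP [/eqP ->|]; first by lia.
    by apply: IH => //; lia.
  have h0 : nlive s (subst h (W 0)) = nlive s (W 0).
    have: {subset W 0 <= W 0} by [].
    move: {1 3 4}(W 0) => u; elim: u => //= x u IH sub.
    rewrite subst_cons nlive_cat IH; last by move=> y yu; apply: sub; rewrite inE yu orbT.
    congr (_ + _).
    have xW : x \in W 0 by apply: sub; exact: mem_head.
    have gx := allP (Wgood 0) _ xW.
    have [lx|/negPf dx] := boolP (live s x); first by rewrite h1 ?lx ?Wlive.
    by apply/eqP; rewrite nlive_eq0 hmass //; have := el x; rewrite /live in dx *; lia.
  move: lt_n; rewrite -W1 /W /= -[frontier X s']/(W 0) /affine !nlive_cat h0.
  by rewrite /nlive (eq_count el); lia.
have [u [u' [w [du _]]]] := strat_useful strat Pc.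
(* One terminal word of length [m (Z, s)] is fixed for each [Z]; these words define the terminal
   morphism [g]. *)
have yield Z : exists y, P (Z, s) ->
    derives [:: Nt Z s] (ter y) /\ size y = m (Z, s).
  case PZ: (P (Z, s)); last by exists [::].
  by have [w' dw sw] := strat_yield strat PZ; exists w'.
have [y yP] := choice yield.
pose g (x : N + T) := match x with inl Z => y Z | inr t => [:: t] end.
apply: (@affine_contains_CD0L _ T h g al be (frontier X s') u u') => n; rewrite -/(W n).
- apply/LG; rewrite /ig_language !map_cat; apply: derives_trans du _.
  apply: derives_cat; first exact: derives_refl.
  apply: (derives_cat (l1 := [:: _])); last exact: derives_refl.
  apply: derives_trans (Wder n s) _; move: (Wgood n).
  elim: (W n) => [|x U IH] /=; first by move=> _; exact: derives_refl.
  move=> /andP [gx /IH d]; rewrite subst_cons map_cat.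
  apply: (derives_cat (l1 := [:: _])) => //.
  case: x gx => [Z|t] /=; last by move=> _; exact: derives_refl.
  by move=> /andP [PZ _]; have [] := yP _ PZ.
- apply: (@leq_trans (nlive s (W n))).
    by elim: n => // n IH; apply: leq_ltn_trans IH (Wgrow n).
  move: (Wgood n); elim: (W n) => //= x U IH /andP [gx /IH le_U].
  rewrite subst_cons size_cat; apply: leq_add le_U.
  case: x gx => [Z|//] /andP [PZ _]; have [_ ->] := yP _ PZ.
  by rewrite /live /=; lia.
Qed.

(** On the empty stack nothing can be popped, so the frontier is a terminal word and all its letters
    are live. *)
Lemma nlive_frontier_start : P (ig_start G, [::]) ->
  nlive [::] (frontier (ig_start G) [::]) = m (ig_start G, [::]).
Proof.
move=> P0; rewrite -mass_frontier //; have := frontier_good P0.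
elim: (frontier _ _) => //= -[Z|t] u IH /andP [gx /IH e]; last first.
  by rewrite -[mass _ _]/(1 + mass [::] u) -e.
have /andP [PZ] := gx; have := strat_ok strat PZ.
by case: (st _) => // rhs [f [s []]].
Qed.

End Frontier.

(** * Existence of the infinite CD0L subset *)

Lemma strategy_CD0L (T : finType) (G : indexed_grammar T) (L : seq T -> Prop) :
  (forall w, L w <-> ig_language G w) -> infinite_lang L -> no_pumping_loop G ->
  exists M : seq T -> Prop,
    (forall u, M u -> L u) /\ infinite_lang M /\ CD0L_language M.
Proof.
move=> LG infL nl.
pose colors : finType := (ig_nt G * {set ig_nt G + T} * {set ig_nt G + T} * {set ig_nt G + T})%type.
(* A word beyond the threshold for the number of colours lets the descent start with no colour
   met. *)
have [w /LG Lw lt_w] := infinite_lang_long (threshold G #|colors|) infL.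
have [P [st [m [r [strat P0 le_w]]]]] := strategy_exists nl Lw.
have [|||c [d [Pc Pd e dsc]]] := @descent_repeats_color _ _ _ _ _ _ strat #|colors| set0 _ _ P0.
- exact: max_card.
- by rewrite (nlive_frontier_start strat P0); apply: leq_trans lt_w le_w.
- by move=> u; rewrite inE.
- exact: (descends_same_color_CD0L strat LG Pc Pd e dsc).
Qed.

Theorem theorem3 (T : finType) (L : seq T -> Prop) :
  indexed_language L -> infinite_lang L ->
  exists M : seq T -> Prop,
    (forall u, M u -> L u) /\ infinite_lang M /\ CD0L_language M.
Proof.
move=> [G LG] infL; have [nl|] := pselect (no_pumping_loop G).
  exact: strategy_CD0L LG infL nl.
exact: pumping_loop_CD0L.
Qed.
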